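(* Let $S$ be a preordered semiring of characteristic zero satisfying $1 \geq 0$, and let $u \in S$ be a polynomially universal element. Then for all nonzero $x, y \in S$, the following are equivalent: (1) $f(x) \geq f(y)$ for every monotone semiring homomorphism $f : S \to \mathbb{R}_+$. (2) For every $r \in \mathbb{R}_+$ and $\varepsilon > 0$, there exist a polynomial $p \in \mathbb{N}[X]$, a nonzero element $z \in S$ and $m \in \mathbb{N}_{>0}$ such that $p(r) \leq \varepsilon m$ and $m\, z\, x + p(u)\, z \geq m\, z\, y$. (3) For every $r \in \mathbb{R}_+$ and $\varepsilon > 0$, there exist a polynomial $p \in \mathbb{N}[X]$, a nonzero element $z \in S$ and $m \in \mathbb{N}_{>0}$ such that $p(r) \leq (1+\varepsilon) m$ and $p(u)\, z\, x \geq m\, z\, y$. (4) For every $r \in \mathbb{R}_+$ and $\varepsilon > 0$, there exist a polynomial $p \in \mathbb{N}[X]$ and $n, m \in \mathbb{N}_{>0}$ such that $p(r) \leq (1+\varepsilon)^n m$ and $p(u)\, x^n \geq m\, y^n$.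
   Context: A semiring is a set with two commutative monoid structures, addition (neutral element $0$) and multiplication (neutral element $1$), with multiplication distributing over addition; a semiring homomorphism preserves $+$, $\cdot$, $0$ and $1$. A semiring $S$ has characteristic zero if the unique semiring homomorphism $\mathbb{N} \to S$ is injective. A preordered semiring is a semiring $S$ with a preorder $\geq$ such that $x \geq y$ implies $x + z \geq y + z$ and $xz \geq yz$ for all $z \in S$. A semiring homomorphism $f: S \to T$ between preordered semirings is monotone if $x \geq y$ implies $f(x) \geq f(y)$; $\mathbb{R}_+$ carries its usual order. For a preordered semiring $S$ with $1 \geq 0$, an element $u \in S$ with $u \geq 1$ is polynomially universal if for every nonzero $x \in S$ there is a polynomial $p \in \mathbb{N}[X]$ with $p(u)\,x \geq 1$ and $p(u) \geq x$. Here $\mathbb{N} = \{0,1,2,\dots\}$ and $\mathbb{N}_{>0}$ denotes the positive integers; for $p \in \mathbb{N}[X]$, $p(u)$ denotes evaluation in $S$ and $p(r)$ evaluation at the real number $r$. *)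

(* Defs.v *)
From mathcomp Require Import all_boot all_order all_algebra.
From mathcomp Require Export Rstruct.
Set Implicit Arguments. Unset Strict Implicit. Unset Printing Implicit Defensive.
Import Order.TTheory GRing.Theory Num.Theory.
Local Open Scope ring_scope.

Definition preordered_semiring (S : comPzSemiRingType) (ge : S -> S -> Prop) : Prop :=
  [/\ (forall x, ge x x),
      (forall x y z, ge x y -> ge y z -> ge x z),
      (forall x y z, ge x y -> ge (x + z) (y + z)) &
      (forall x y z, ge x y -> ge (x * z) (y * z))].

Definition char_zero (S : comPzSemiRingType) : Prop :=
  injective (fun n : nat => (n%:R : S)).

Definition peval (S : comPzSemiRingType) (p : {poly nat}) (x : S) : S :=
  \sum_(i < size p) (nth 0%N (polyseq p) i)%:R * x ^+ i.

Definition poly_universal (S : comPzSemiRingType) (ge : S -> S -> Prop) (u : S) : Prop :=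
  ge u 1 /\
  forall x : S, x != 0 ->
    exists p : {poly nat}, ge (peval p u * x) 1 /\ ge (peval p u) x.

Definition monotone_hom_Rplus (S : comPzSemiRingType) (ge : S -> S -> Prop)
    (f : S -> Rdefinitions.R) : Prop :=
  [/\ (forall x, 0 <= f x),
      (forall x y, f (x + y) = f x + f y),
      (forall x y, f (x * y) = f x * f y),
      f 0 = 0 /\ f 1 = 1 &
      (forall x y, ge x y -> f y <= f x)].

(* Main.v *)
(** Strassen-style representation argument.  If the additive relaxation fails
    at [(r, eps)], pick a natural [k > r] and an [M] with [2 <= eps * M], and
    adjoin the relations [k >= u] and [M y >= M x + 1].  The enlarged preorder
    never proves [n >= n + 1]: such a proof, multiplied by a long geometric sum
    of [u] and [k], would yield the missing relaxed inequality.  Thanks to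
    [k >= u] it is archimedean, so a maximal extension (Zorn) is total, and
    [a |-> sup {i / j | j a >= i}] is a monotone homomorphism for it, which
    satisfies [f x < f y].  Conversely, multiplicative slack absorbs additive
    slack since [q(u) x >= 1], and iterating an inequality that holds up to a
    factor [z] makes [z] asymptotically negligible. *)
Require Import Defs.
From mathcomp Require Import all_boot all_order all_algebra.
From mathcomp Require Import Rstruct.
From mathcomp Require Import boolp classical_sets reals ring lra.
Import Order.TTheory GRing.Theory Num.Theory.
Local Open Scope ring_scope.

Set Implicit Arguments.
Unset Strict Implicit.

Local Notation R := Rdefinitions.R.

(** * Evaluation of natural polynomials in a semiring *)

Section PolynomialEvaluation.
Variable S : comPzSemiRingType.
Implicit Types (p q : {poly nat}) (x : S).

(** Padding with zero coefficients puts polynomials of different sizes over one index range. *)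
Lemma peval_wide n p x : (size p <= n)%N ->
  peval p x = \sum_(i < n) (p`_i)%R%:R * x ^+ i.
Proof.
move=> le_pn; rewrite /peval (big_ord_widen n (fun i => (p`_i)%R%:R * x ^+ i)) //.
rewrite big_mkcond; apply: eq_bigr => i _; case: ltnP => // /(nth_default 0) ->.
by rewrite mul0r.
Qed.

Lemma pevalD p q x : peval (p + q) x = peval p x + peval q x.
Proof.
rewrite !(@peval_wide (maxn (size p) (size q))) ?leq_maxl ?leq_maxr //;
  last exact: size_polyD.
by rewrite -big_split; apply: eq_bigr => i _; rewrite coefD natrD mulrDl.
Qed.

Lemma pevalC n x : peval n%:P x = n%:R.
Proof.
by rewrite (@peval_wide 1) ?size_polyC_leq1 // big_ord1 coefC mulr1.
Qed.

Lemma peval0 x : peval 0 x = 0.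
Proof. by rewrite -[0]/(0%N%:P) pevalC. Qed.

Lemma pevalMX p x : peval (p * 'X) x = peval p x * x.
Proof.
rewrite (@peval_wide (size p).+1); last first.
  by apply: leq_trans (size_polyMleq _ _) _; rewrite size_polyX addn2.
rewrite big_ord_recl coefMX /= mul0r add0r big_distrl.
by apply: eq_bigr => i _; rewrite coefMX /= exprSr mulrA.
Qed.

Lemma pevalCM n p x : peval (n%:P * p) x = n%:R * peval p x.
Proof.
rewrite (@peval_wide (size p)) ?big_distrr; last first.
  by rewrite mul_polyC size_scale_leq.
by apply: eq_bigr => i _ /=; rewrite coefCM natrM mulrA.
Qed.

Lemma pevalM p q x : peval (p * q) x = peval p x * peval q x.
Proof.
elim/poly_ind: p => [|p c IHp]; first by rewrite mul0r !peval0 mul0r.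
rewrite mulrDl !pevalD pevalMX pevalC pevalCM mulrDl.
by rewrite -mulrA ['X * q]mulrC mulrA pevalMX IHp mulrAC.
Qed.

Lemma pevalXn n x : peval ('X^n) x = x ^+ n.
Proof.
elim: n => [|n IHn]; first by rewrite -[_ ^+ 0]/(1%N%:P) pevalC.
by rewrite !exprSr pevalMX IHn.
Qed.

Lemma peval_exp p n x : peval (p ^+ n) x = peval p x ^+ n.
Proof.
elim: n => [|n IHn]; first by rewrite -[p ^+ 0]/(1%N%:P) pevalC.
by rewrite !exprSr pevalM IHn.
Qed.

End PolynomialEvaluation.

(** * Estimates in the real numbers *)

Lemma peval_ge0 (p : {poly nat}) (r : R) : 0 <= r -> 0 <= peval p r.
Proof.
by move=> r0; apply: sumr_ge0 => i _; rewrite mulr_ge0 ?ler0n ?exprn_ge0.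
Qed.

Lemma bernoulli (h : R) n : 0 <= h -> 1 + n%:R * h <= (1 + h) ^+ n.
Proof.
move=> h0; elim: n => [|n IHn]; first by rewrite mul0r addr0 expr0.
rewrite exprS -natr1; have n0 : 0 <= n%:R :> R by rewrite ler0n.
have : (1 + h) * (1 + n%:R * h) <= (1 + h) * (1 + h) ^+ n by rewrite ler_wpM2l //; lra.
by apply: le_trans; nra.
Qed.

Lemma exists_nat_ge (c : R) : exists2 n, (0 < n)%N & c <= n%:R.
Proof. by exists (Num.truncn c).+1 => //; apply/ltW/truncnS_gt. Qed.

(** Writing [b = a * (1 + h)], Bernoulli bounds [(b / a) ^+ n] below by [1 + n h], which passes
    [c / d] once [n >= c / (d h)]. For [a = 0] the exponent 1 already kills the left side. *)
Lemma expr_dominated (a b c d : R) : 0 <= a -> a < b -> 0 < d ->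
  exists2 n, (0 < n)%N & c * a ^+ n <= d * b ^+ n.
Proof.
move=> a0 ab d0; have b0 : 0 < b by apply: le_lt_trans ab.
have [->|a_neq0] := eqVneq a 0.
  by exists 1%N => //; rewrite !expr1 mulr0 mulr_ge0 // ltW.
have {a_neq0}a0 : 0 < a by rewrite lt_neqAle eq_sym a_neq0.
pose h := b / a - 1; have h0 : 0 < h by rewrite subr_gt0 ltr_pdivlMr ?mul1r.
have bE : b = a * (1 + h) by rewrite /h; field; rewrite gt_eqF.
have [n n0 cn] := exists_nat_ge (c / (d * h)).
exists n => //; rewrite bE exprMn mulrCA [c * _]mulrC ler_wpM2l ?exprn_ge0 ?(ltW a0) //.
apply: (@le_trans _ _ (d * (1 + n%:R * h))); last first.
  by rewrite ler_wpM2l ?(ltW d0) // bernoulli // ltW.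
by move: cn; rewrite ler_pdivrMr ?mulr_gt0 //; nra.
Qed.

Lemma archimedean_le0 (v c : R) :
  (forall n, (0 < n)%N -> n%:R * v <= c) -> v <= 0.
Proof.
move=> vc; rewrite leNgt; apply/negP => v0.
have [n n0 cn] := exists_nat_ge ((c + 1) / v).
by move: cn (vc n n0); rewrite ler_pdivrMr //; lra.
Qed.

(** * Preordered semirings and adjunction of a relation *)

Section PreorderedSemiring.
Variables (S : comPzSemiRingType) (ge : S -> S -> Prop).
Hypotheses (hS : preordered_semiring ge) (h10 : ge 1 0).
Implicit Types a b c d s : S.

Lemma pge_refl a : ge a a.
Proof. by case: hS. Qed.

Lemma pge_trans b a c : ge a b -> ge b c -> ge a c.
Proof. by case: hS => _ + _ _; apply. Qed.

Lemma pge_add a b c d : ge a b -> ge c d -> ge (a + c) (b + d).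
Proof.
case: hS => _ _ hD _ ab cd; apply: (@pge_trans (b + c)); first exact: hD.
by rewrite ![b + _]addrC; apply: hD.
Qed.

Lemma pge_mul a b c d : ge a b -> ge c d -> ge (a * c) (b * d).
Proof.
case: hS => _ _ _ hM ab cd; apply: (@pge_trans (b * c)); first exact: hM.
by rewrite ![b * _]mulrC; apply: hM.
Qed.

Lemma pge_mul2r a b c : ge a b -> ge (a * c) (b * c).
Proof. by move=> ab; apply: pge_mul (pge_refl _). Qed.

Lemma pge_mul2l a b c : ge a b -> ge (c * a) (c * b).
Proof. by move=> ab; apply: pge_mul => //; apply: pge_refl. Qed.

Lemma pge_add2r a b c : ge a b -> ge (a + c) (b + c).
Proof. by move=> ab; apply: pge_add (pge_refl _). Qed.

Lemma pge_add2l a b c : ge a b -> ge (c + a) (c + b).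
Proof. by move=> ab; apply: pge_add => //; apply: pge_refl. Qed.

Lemma pge0 a : ge a 0.
Proof. by have := pge_mul2r a h10; rewrite mul1r mul0r. Qed.

Lemma pge_addr a b : ge (a + b) a.
Proof. by rewrite -[X in ge _ X]addr0; apply/pge_add2l/pge0. Qed.

Lemma pge_addl a b : ge (b + a) a.
Proof. by rewrite addrC; apply: pge_addr. Qed.

Lemma pge_exp a b n : ge a b -> ge (a ^+ n) (b ^+ n).
Proof.
move=> ab; elim: n => [|n IHn]; first exact: pge_refl.
by rewrite !exprS; apply: pge_mul.
Qed.

Lemma pge_nat m n : (n <= m)%N -> ge m%:R n%:R.
Proof. by move=> /subnKC <-; rewrite natrD; apply: pge_addr. Qed.

Lemma pge_degenerate a b : ge 0 1 -> ge a b.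
Proof.
move=> h01; apply: (@pge_trans 0); first exact: pge0.
by have := pge_mul2r b h01; rewrite mul1r mul0r.
Qed.

Lemma peval_monotone (p : {poly nat}) a b : ge a b -> ge (peval p a) (peval p b).
Proof.
move=> ab; rewrite /peval; apply: (big_ind2 ge); first exact: pge_refl.
- by move=> *; apply: pge_add.
- by move=> i _; apply/pge_mul2l/pge_exp.
Qed.

(** The summand [c] acts as a catalyst: each step trades one [a] for one [b] and returns [c], so a
    single copy serves any [n]. *)
Lemma pge_cancel_iter c a b n :
  ge (c + a) (c + b) -> ge (c + n%:R * a) (c + n%:R * b).
Proof.
move=> h; elim: n => [|n IHn]; first by rewrite !mul0r; apply: pge_refl.
have -> : c + n.+1%:R * a = c + n%:R * a + a by rewrite -natr1; ring.
apply: (@pge_trans (c + n%:R * b + a)); first exact: pge_add2r.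
have -> : c + n%:R * b + a = c + a + n%:R * b by ring.
have -> : c + n.+1%:R * b = c + b + n%:R * b by rewrite -natr1; ring.
exact: pge_add2r.
Qed.

(* [w] is the homogeneous sum of the [a ^+ i * b ^+ (n - i)]. *)
Lemma geometric_sum a b n :
  exists2 w, w * a + b ^+ n.+1 = a ^+ n.+1 + w * b & ge w (b ^+ n).
Proof.
elim: n => [|n [w wE wge]].
  by exists 1; [rewrite !expr1; ring | apply: pge_refl].
(* The monomials of the new homogeneous sum that contain [b], plus the pure power of [a]. *)
exists (b * w + a ^+ n.+1); last first.
  by apply: pge_trans (pge_addr _ _) _; rewrite exprS; apply: pge_mul2l.
transitivity (b * (w * a + b ^+ n.+1) + a ^+ n.+2); first by rewrite !exprS; ring.
by rewrite wE !exprS; ring.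
Qed.

(* The preorder obtained by adding the relation [ge a b]. *)
Definition adjoin a b c d := exists s, ge (c + s * b) (d + s * a).

Lemma adjoin_sub a b c d : ge c d -> adjoin a b c d.
Proof. by exists 0; rewrite !mul0r !addr0. Qed.

Lemma adjoin_rel a b : adjoin a b a b.
Proof. by exists 1; rewrite !mul1r addrC; apply: pge_refl. Qed.

(** Multipliers add under transitivity, scale under multiplication and are unchanged by addition. *)
Lemma adjoin_preordered a b : preordered_semiring (adjoin a b).
Proof.
split=> [c|c d e [s h1] [t h2]|c d e [s h]|c d e [s h]].
- exact/adjoin_sub/pge_refl.
- exists (s + t); apply: (@pge_trans (d + s * a + t * b)).
    have -> : c + (s + t) * b = c + s * b + t * b by ring.
    exact: pge_add2r.
  have -> : d + s * a + t * b = d + t * b + s * a by ring.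
  have -> : e + (s + t) * a = e + t * a + s * a by ring.
  exact: pge_add2r.
- by exists s; rewrite ![_ + e + _]addrAC; apply: pge_add2r.
- by exists (s * e); rewrite ![s * e * _]mulrAC -!mulrDl; apply: pge_mul2r.
Qed.

(** Required for every [n], because addition need not be cancellative: [n >= n + 1] does not give
    [0 >= 1]. *)
Definition consistent := forall n : nat, ~ ge n%:R n.+1%:R.

(** Polynomial universality with natural numbers in place of the values [p(u)]. *)
Definition archimedean := forall a, (exists n : nat, ge n%:R a) /\
  (a != 0 -> exists n : nat, ge (n%:R * a) 1).

Lemma pge_nat_le m n : consistent -> ge m%:R n%:R -> (n <= m)%N.
Proof.
move=> cons mn; rewrite leqNgt; apply/negP => lt_mn; apply: (cons m).
by apply: pge_trans mn _; apply: pge_nat.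
Qed.

End PreorderedSemiring.

Arguments pge_trans {S ge} hS b {a c}.
Arguments pge_mul2l {S ge} hS {a b} c.
Arguments pge_mul2r {S ge} hS {a b} c.
Arguments pge_add2l {S ge} hS {a b} c.
Arguments pge_add2r {S ge} hS {a b} c.
Arguments pge_cancel_iter {S ge} hS {c a b} n.

(** * The homomorphism attached to a bounded total preorder *)

Section TotalPreorder.
Variables (S : comPzSemiRingType) (ge : S -> S -> Prop).
Hypotheses (hS : preordered_semiring ge) (h10 : ge 1 0).
Hypotheses (cons : consistent ge) (total : forall a b, ge a b \/ ge b a).
Hypothesis bounded : forall a, exists n : nat, ge n%:R a.
Implicit Types a b c d s : S.

Let cut a : set R :=
  [set v | exists i j : nat, [/\ (0 < j)%N, ge (j%:R * a) i%:R & v = i%:R / j%:R]].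

Let f a := sup (cut a).

(** Cross-multiplying [i >= n a] with any [j a >= i'] compares two naturals, and consistency
    reflects this to [i' n <= i j]. *)
Let f_ub a (n i : nat) : (0 < n)%N -> ge i%:R (n%:R * a) -> n%:R * f a <= i%:R.
Proof.
move=> n0 h; rewrite mulrC -ler_pdivlMr ?ltr0n //; apply: ge_sup.
  by exists 0, 0%N, 1%N; split; rewrite ?mul0r //; apply: pge0.
move=> _ [i' [j [j0 h' ->]]].
rewrite ler_pdivrMr ?ltr0n // mulrAC ler_pdivlMr ?ltr0n // -!natrM ler_nat.
apply: (pge_nat_le hS h10) => //; rewrite !natrM.
apply: (pge_trans hS (n%:R * a * j%:R)); first exact: pge_mul2r.
by rewrite -mulrA mulrC [a * _]mulrC; apply: pge_mul2r.
Qed.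

Let f_lb a (n i : nat) : (0 < n)%N -> ge (n%:R * a) i%:R -> i%:R <= n%:R * f a.
Proof.
move=> n0 h; rewrite [_ * f a]mulrC -ler_pdivrMr ?ltr0n //; apply: sup_upper_bound.
  split; first by exists (i%:R / n%:R), i, n; split.
  (* The supremum is informative only for a bounded set; a natural above [a] bounds the cut. *)
  have [m hm] := bounded a; exists m%:R => _ [i' [j [j0 h' ->]]].
  rewrite ler_pdivrMr ?ltr0n // -natrM ler_nat.
  apply: (pge_nat_le hS h10) => //; rewrite natrM mulrC.
  by apply: (pge_trans hS _ _ h'); apply: pge_mul2l.
by exists i, n; split.
Qed.

(** Totality enters here: for the largest [i] with [n a >= i], the failure of [n a >= i + 1] forces
    [i + 1 >= n a]. *)
Let floor a (n : nat) : exists i : nat, ge (n%:R * a) i%:R /\ ge i.+1%:R (n%:R * a).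
Proof.
have [m hm] := bounded (n%:R * a).
pose P (i : nat) := `[< ge (n%:R * a) i%:R >].
have exP : exists i, P i by exists 0%N; apply/asboolP; apply: pge0.
have ubP i : P i -> (i <= m)%N.
  by move=> /asboolP h; apply: (pge_nat_le hS h10) => //; exact: (pge_trans hS _ hm h).
case: (ex_maxnP exP ubP) => i /asboolP hi maxi; exists i; split=> //.
case: (total i.+1%:R (n%:R * a)) => // /asboolP/maxi.
by rewrite ltnn.
Qed.

(** The same [i] and [i + 1] enclose [n a] in the semiring and [n * f a] in the reals, so laws of
    [S] pass to [f] up to an error that vanishes after division by [n]. *)
Let f_approx a (n : nat) : (0 < n)%N -> exists i : nat,
  [/\ ge (n%:R * a) i%:R, ge i.+1%:R (n%:R * a), i%:R <= n%:R * f a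
    & n%:R * f a <= i%:R + 1].
Proof.
move=> n0; have [i [h1 h2]] := floor a n; exists i; split=> //; first exact: f_lb.
by rewrite natr1; apply: f_ub.
Qed.

Let f_ge0 a : 0 <= f a.
Proof. by have := @f_lb a 1 0 isT (pge0 hS h10 _); rewrite mul1r. Qed.

Let f_monotone a b : ge a b -> f b <= f a.
Proof.
move=> ab; rewrite -subr_le0; apply: (@archimedean_le0 _ 1) => n n0.
have [i [h1 h2 h3 h4]] := f_approx b n0.
have := @f_lb a n i n0 (pge_trans hS _ (pge_mul2l hS _ ab) h1).
by rewrite mulrBr; lra.
Qed.

Let fD a b : f (a + b) = f a + f b.
Proof.
apply/eqP; rewrite eq_le -subr_le0 -[X in _ && X]subr_le0; apply/andP.
have main n : (0 < n)%N -> n%:R * (f (a + b) - (f a + f b)) <= 2 /\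
    n%:R * (f a + f b - f (a + b)) <= 2.
  move=> n0; have [i [a1 a2 a3 a4]] := f_approx a n0.
  have [j [b1 b2 b3 b4]] := f_approx b n0.
  have := @f_lb (a + b) n (i + j) n0; rewrite mulrDr natrD.
  move=> /(_ (pge_add hS a1 b1)).
  have := @f_ub (a + b) n (i.+1 + j.+1) n0; rewrite mulrDr natrD.
  by move=> /(_ (pge_add hS a2 b2)); rewrite natrD -!natr1; lra.
by split; apply: (@archimedean_le0 _ 2) => n /main[].
Qed.

(** Multiplying the enclosures at scale [n * n] leaves an error of at most [i + j + 1], hence at
    most [n * (f a + f b + 1)]; dividing by [n] gives a bound independent of [n]. *)
Let fM a b : f (a * b) = f a * f b.
Proof.
apply/eqP; rewrite eq_le -subr_le0 -[X in _ && X]subr_le0; apply/andP.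
have main n : (0 < n)%N -> n%:R * (f (a * b) - f a * f b) <= f a + f b + 1 /\
    n%:R * (f a * f b - f (a * b)) <= f a + f b + 1.
  move=> n0; have [i [a1 a2 a3 a4]] := f_approx a n0.
  have [j [b1 b2 b3 b4]] := f_approx b n0.
  have nn0 : (0 < n * n)%N by rewrite muln_gt0 n0.
  have nE : (n * n)%:R * (a * b) = n%:R * a * (n%:R * b) :> S by rewrite natrM; ring.
  have := @f_lb (a * b) (n * n) (i * j) nn0; rewrite nE natrM.
  move=> /(_ (pge_mul hS a1 b1)).
  have := @f_ub (a * b) (n * n) (i.+1 * j.+1) nn0; rewrite nE natrM.
  move=> /(_ (pge_mul hS a2 b2)).
  rewrite !natrM -!natr1.
  have n1 : 1 <= n%:R :> R by rewrite ler1n.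
  have i0 : 0 <= i%:R :> R by rewrite ler0n.
  have j0 : 0 <= j%:R :> R by rewrite ler0n.
  have fa := f_ge0 a; have fb := f_ge0 b.
  have lo : i%:R * j%:R <= n%:R * f a * (n%:R * f b) by apply: ler_pM.
  have hi : n%:R * f a * (n%:R * f b) <= (i%:R + 1) * (j%:R + 1).
    by apply: ler_pM => //; rewrite mulr_ge0 // ler0n.
  move=> h1 h2; have n_gt0 : 0 < n%:R :> R by rewrite ltr0n.
  by split; rewrite -(ler_pM2l n_gt0); lra.
by split; apply: (@archimedean_le0 _ (f a + f b + 1)) => n /main[].
Qed.

Lemma total_preorder_hom : exists f, monotone_hom_Rplus ge f.
Proof.
exists f; split=> //; split; apply/eqP; rewrite eq_le.
  by have := @f_ub 0 1 0 isT; rewrite !mulr0 mul1r f_ge0 => ->//; apply: pge_refl.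
have := @f_ub 1 1 1 isT; have := @f_lb 1 1 1 isT.
by rewrite !mul1r => -> => [->|] //; apply: pge_refl.
Qed.

End TotalPreorder.

(** * Extension to a total preorder *)

Section Extension.
Variables (S : comPzSemiRingType) (ge : S -> S -> Prop).
Hypotheses (hS : preordered_semiring ge) (h10 : ge 1 0).
Hypotheses (cons : consistent ge) (arch : archimedean ge).
Implicit Types a b c d s : S.

(* Otherwise both [ge a b] and [ge b a] can be refuted; multiplying and adding
   the two refutations gives [ge c (c + d)] with [d] nonzero. *)
Lemma consistent_adjoin a b :
  consistent (adjoin ge a b) \/ consistent (adjoin ge b a).
Proof.
apply: contrapT => /not_orP[/existsNP[m /contrapT[s hs]] /existsNP[n /contrapT[t ht]]].
have s_neq0 : s != 0.
  by apply/eqP => s0; apply: (@cons m); move: hs; rewrite s0 !mul0r !addr0.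
(* Adding [t] times the first refutation to [s] times the second makes the cross terms [s t a] and
   [s t b] occur on both sides, with a surplus [s + t] on the smaller side. *)
pose c := t * m%:R + s * n%:R + s * t * (a + b).
have cd : ge c (c + (s + t)).
  have := pge_add hS (pge_mul2l hS t hs) (pge_mul2l hS s ht).
  rewrite -!natr1.
  have <- : c = t * (m%:R + s * b) + s * (n%:R + t * a) by rewrite /c; ring.
  by congr ge; rewrite /c; ring.
have [_ /(_ s_neq0)[k hk]] := arch s.
have h1 : ge (k%:R * c) (k%:R * c + 1).
  apply: (pge_trans hS (k%:R * (c + (s + t)))); first exact: pge_mul2l.
  have -> : k%:R * (c + (s + t)) = k%:R * c + k%:R * s + k%:R * t by ring.
  by apply: (pge_trans hS _ (pge_addr hS h10 _ _)); apply: pge_add2l.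
(* Iterating [l + 1] times gives [l >= k c >= k c + (l + 1) >= l + 1]. *)
have [[l hl] _] := arch (k%:R * c).
have := @pge_cancel_iter _ _ hS (k%:R * c) 0 1 l.+1; rewrite !addr0 mulr0 mulr1 addr0.
move=> /(_ h1) h2; apply: (@cons l); apply: (pge_trans hS _ hl).
by apply: (pge_trans hS _ h2); apply: pge_addl.
Qed.

End Extension.

Lemma exists_total_extension (S : comPzSemiRingType) (ge : S -> S -> Prop) :
  preordered_semiring ge -> ge 1 0 -> consistent ge -> archimedean ge ->
  exists ge' : S -> S -> Prop,
    [/\ preordered_semiring ge', forall a b, ge a b -> ge' a b,
        consistent ge' & forall a b, ge' a b \/ ge' b a].
Proof.
move=> hS h10 cons arch.
pose good (Q : S -> S -> Prop) :=
  [/\ preordered_semiring Q, forall a b, ge a b -> Q a b & consistent Q].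
pose T := {Q | good Q}.
pose le (P Q : T) := `[< forall a b, sval P a b -> sval Q a b >].
have good_ge : good ge by split.
have [||A totA|[Q [hQ subQ consQ]] maxQ] := @ZL_preorder T (exist _ ge good_ge) le.
- by move=> P; apply/asboolP.
- by move=> P Q V /asboolP PQ /asboolP QV; apply/asboolP => a b /PQ/QV.
(* A nonempty chain is bounded by its union; the empty chain needs [ge] itself, since the empty
   union is not reflexive. *)
- have [[P0 AP0]|nA] := pselect (exists P, A P); last first.
    by exists (exist _ ge good_ge) => P AP; case: nA; exists P.
  pose U a b := exists2 P, A P & sval P a b.
  suff gU : good U by exists (exist _ U gU) => P AP; apply/asboolP => a b; exists P.
  split.
  + split=> [a|a b c [P AP ab] [P' AP' bc]|a b c [P AP ab]|a b c [P AP ab]].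
    * by exists P0 => //; case: (svalP P0) => hP _ _; apply: pge_refl.
    * have [/asboolP PP'|/asboolP PP'] := totA _ _ AP AP'.
        exists P' => //; case: (svalP P') => hP _ _.
        exact: (pge_trans hP b) (PP' _ _ ab) bc.
      exists P => //; case: (svalP P) => hP _ _.
      exact: (pge_trans hP b) ab (PP' _ _ bc).
    * by exists P => //; case: (svalP P) => hP _ _; apply: pge_add2r.
    * by exists P => //; case: (svalP P) => hP _ _; apply: pge_mul2r.
  + by move=> a b ab; exists P0 => //; case: (svalP P0) => _ + _; apply.
  + by move=> n [P AP]; case: (svalP P) => _ _ +; apply.
exists Q; split=> // a b.
have archQ : archimedean Q.
  move=> c; have [[n hn] h] := arch c; split; first by exists n; apply/subQ.
  by move=> /h[m hm]; exists m; apply/subQ.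
(* A consistent adjunction is again a good extension, so maximality puts the new relation in [Q]
   already. *)
have maximal c d : consistent (adjoin Q c d) -> Q c d.
  move=> consA.
  have gA : good (adjoin Q c d).
    by split=> [|e g /subQ|//]; [apply: adjoin_preordered | apply: adjoin_sub].
  have QA : `[< forall e g, Q e g -> adjoin Q c d e g >].
    by apply/asboolP => e g; apply: adjoin_sub.
  by have /asboolP := maxQ (exist _ _ gA) QA; apply; apply: adjoin_rel.
by have [/maximal|/maximal] := consistent_adjoin hQ (subQ _ _ h10) consQ archQ a b;
  [left|right].
Qed.

Lemma exists_monotone_hom (S : comPzSemiRingType) (ge : S -> S -> Prop) :
  preordered_semiring ge -> ge 1 0 -> consistent ge -> archimedean ge ->
  exists f, monotone_hom_Rplus ge f.
Proof.
move=> hS h10 cons arch.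
have [Q [hQ subQ consQ totQ]] := exists_total_extension hS h10 cons arch.
have [|f [f0 fD fM f01 fmon]] := total_preorder_hom hQ (subQ _ _ h10) consQ totQ.
  by move=> a; have [[n hn] _] := arch a; exists n; apply: subQ.
by exists f; split=> // a b /subQ; apply: fmon.
Qed.

(** * Monotone homomorphisms on numerals, powers and polynomials *)

Lemma hom_nat (S : comPzSemiRingType) (ge : S -> S -> Prop) f n :
  monotone_hom_Rplus ge f -> f n%:R = n%:R.
Proof.
case=> _ fD _ [f0 f1] _; elim: n => [|n IHn]; first exact: f0.
by rewrite -!natr1 fD IHn f1.
Qed.

Lemma hom_exp (S : comPzSemiRingType) (ge : S -> S -> Prop) f a n :
  monotone_hom_Rplus ge f -> f (a ^+ n) = f a ^+ n.
Proof.
case=> _ _ fM [_ f1] _; elim: n => [|n IHn]; first by rewrite !expr0.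
by rewrite !exprS fM IHn.
Qed.

Lemma hom_peval (S : comPzSemiRingType) (ge : S -> S -> Prop) f p a :
  monotone_hom_Rplus ge f -> f (peval p a) = peval p (f a).
Proof.
move=> hf; case: (hf) => _ fD fM [f0 _] _; rewrite /peval (big_morph f fD f0).
by apply: eq_bigr => i _; rewrite fM (hom_nat _ hf) (hom_exp _ _ hf).
Qed.

(** * The cycle of implications for a polynomially universal element *)

Section PolynomiallyUniversal.
Variables (S : comPzSemiRingType) (ge : S -> S -> Prop).
Hypotheses (hS : preordered_semiring ge) (h10 : ge 1 0).
Variable u : S.
Hypothesis hu : poly_universal ge u.
Implicit Types (a b c d s x y z : S) (p q : {poly nat}).

Lemma poly_upper_bound a : exists p, ge (peval p u) a.
Proof.
have [->|/hu.2[p [_ h]]] := eqVneq a 0; last by exists p.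
by exists 0; rewrite peval0; apply: pge_refl.
Qed.

Lemma pge1_neq0 z : ~ ge 0 1 -> ge z 1 -> z != 0.
Proof. by move=> n01 z1; apply/eqP => z0; apply: n01; rewrite -z0. Qed.

(** Once [k] bounds [u], each [p(u)] is bounded by [p(k)], a natural number ([peval p k] is computed
    in [nat]), so polynomial bounds become numerical. *)
Lemma archimedean_of_pge_nat (Q : S -> S -> Prop) (k : nat) :
  preordered_semiring Q -> (forall a b, ge a b -> Q a b) -> Q k%:R u ->
  archimedean Q.
Proof.
move=> hQ subQ ku.
have pE p : peval p (k%:R : S) = (peval p k)%:R.
  rewrite /peval natr_sum; apply: eq_bigr => i _.
  by rewrite natrM natrX natn.
move=> a; split.
  have [p hp] := poly_upper_bound a; exists (peval p k); rewrite -pE.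
  apply: (pge_trans hQ (peval p u)); last exact: subQ.
  exact: peval_monotone.
move=> /hu.2[p [hp _]]; exists (peval p k); rewrite -pE.
apply: (pge_trans hQ (peval p u * a)); last exact: subQ.
by apply: pge_mul2r => //; apply: peval_monotone.
Qed.

(* Multiplying the hypothesis by the geometric sum of [u] and [k] turns
   [d * u] and [d * k] into [d * u ^+ n.+1] and [d * k ^+ n.+1]; the former is
   negligible at [r < k], and repeated addition makes [c] negligible. *)
Lemma eliminate_bound x y c s d (M k : nat) (r eps : R) :
  ~ ge 0 1 -> ge s 1 -> 0 <= r -> r < k%:R -> 0 < eps -> (0 < M)%N ->
  2 <= eps * M%:R ->
  ge (c + s * (M%:R * x + 1) + d * u) (c + s * (M%:R * y) + d * k%:R) ->
  exists p z (m : nat),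
    [/\ z != 0, (0 < m)%N, peval p r <= eps * m%:R &
        ge (m%:R * z * x + peval p u * z) (m%:R * z * y)].
Proof.
move=> n01 s1 r0 rk eps0 M0 epsM h.
have k0 : (0 < k)%N by rewrite -(ltr0n R); apply: le_lt_trans rk.
have M1 : 1 <= M%:R :> R by rewrite ler1n.
have [q hq] := poly_upper_bound d.
(* Budget for the final [eps * M * N]: half pays for the constant [N], as [2 <= eps * M]; a quarter
   for the term with [q]; the rest for [v]. *)
have eM0 : 0 < eps * M%:R / 4 by lra.
have [n _ hn] := expr_dominated (peval q r * r) r0 rk eM0.
have [w wE wge] := geometric_sum hS h10 u k%:R n.
pose C := w * c + d * w * k%:R.
pose A := w * s * (M%:R * x + 1) + d * u ^+ n.+1.
pose B := w * s * (M%:R * y).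
(* Multiply the hypothesis by [w] and add [d * k ^+ n.+1] to both sides; [wE] then exposes
   [d * w * k] on the left as well, so it joins the common summand [C]. *)
have CAB : ge (C + A) (C + B).
  apply: (pge_trans hS (C + B + d * k%:R ^+ n.+1)); last exact: pge_addr.
  have -> : C + A = w * (c + s * (M%:R * x + 1) + d * u) + d * k%:R ^+ n.+1.
    transitivity (w * c + w * s * (M%:R * x + 1) + d * (u ^+ n.+1 + w * k%:R)).
      by rewrite /C /A; ring.
    by rewrite -wE; ring.
  apply: pge_add2r => //.
  have -> : C + B = w * (c + s * (M%:R * y) + d * k%:R) by rewrite /C /B; ring.
  exact: pge_mul2l.
have [v hv] := poly_upper_bound C.
have kn1 : 1 <= k%:R ^+ n :> R by rewrite exprn_ege1 // ler1n.
have [j j0 hj] := exists_nat_ge (4 * peval v r).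
have j1 : 1 <= j%:R :> R by rewrite ler1n.
(* The factor [k ^ n] of [N] is absorbed by [w * s >= k ^+ n], so the [N] copies of [d * u ^+ n.+1]
   cost only [j] copies of [q(u) * u ^+ n.+1]. *)
pose N := (j * k ^ n)%N.
have N0 : (0 < N)%N by rewrite muln_gt0 j0 expn_gt0 k0.
have ws_ge : ge (w * s) (k%:R ^+ n).
  by rewrite -[X in ge _ X]mulr1; apply: pge_mul.
have ws1 : ge (w * s) 1.
  apply: (pge_trans hS _ ws_ge); rewrite -natrX.
  by apply: (@pge_nat _ _ hS h10 _ 1); rewrite expn_gt0 k0.
exists (N%:P + j%:P * q * 'X^(n.+1) + v), (w * s), (N * M)%N; split.
- exact: pge1_neq0.
- by rewrite muln_gt0 N0.
- rewrite !pevalD !pevalM !pevalC pevalXn !natrM natrX.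
  set K := k%:R ^+ n in kn1 hn *.
  have jK : j%:R <= j%:R * K by rewrite ler_peMr ?ler0n.
  have E1 : j%:R * K * 2 <= j%:R * K * (eps * M%:R).
    by rewrite ler_wpM2l // mulr_ge0 ?ler0n // (le_trans ler01).
  have E2 : j%:R * (peval q r * r * r ^+ n) <= j%:R * (eps * M%:R / 4 * K).
    by rewrite ler_wpM2l ?ler0n.
  by rewrite exprS; lra.
(* [C] is paid for once, by [v], however large [N] is. *)
- have := pge_cancel_iter hS N CAB.
  move=> /(pge_trans hS _)-/(_ _ (pge_addl hS h10 _ _)).
  rewrite /A /B => hfin.
  have -> : (N * M)%:R * (w * s) * y = N%:R * (w * s * (M%:R * y)) by rewrite natrM; ring.
  apply: (pge_trans hS _ _ hfin).
  rewrite !pevalD !pevalM !pevalC pevalXn.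
  have -> : (N * M)%:R * (w * s) * x +
      (N%:R + j%:R * peval q u * u ^+ n.+1 + peval v u) * (w * s) =
      peval v u * (w * s) + (N%:R * (w * s * (M%:R * x + 1)) +
        j%:R * peval q u * u ^+ n.+1 * (w * s)) by rewrite natrM; ring.
  apply: pge_add => //.
    by rewrite -[C]mulr1; apply: pge_mul.
  rewrite [N%:R * (_ + d * _)]mulrDr; apply: pge_add2l => //.
  have -> : N%:R * (d * u ^+ n.+1) = j%:R * d * u ^+ n.+1 * k%:R ^+ n :> S.
    by rewrite /N natrM natrX; ring.
  by apply: pge_mul => //; apply: pge_mul2r => //; apply: pge_mul2l.
Qed.

Lemma hom_le_relaxed_add x y : x != 0 ->
  (forall f, monotone_hom_Rplus ge f -> f y <= f x) ->
  forall r eps : R, 0 <= r -> 0 < eps -> exists p z (m : nat),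
    [/\ z != 0, (0 < m)%N, peval p r <= eps * m%:R &
        ge (m%:R * z * x + peval p u * z) (m%:R * z * y)].
Proof.
move=> x0 fxy r eps r0 eps0.
(* If [0 >= 1], all elements are comparable and any witness works; otherwise elements above 1 are
   nonzero, as the choice of [z] requires. *)
have [h01|n01] := pselect (ge 0 1).
  exists 0, x, 1%N; split => //; last exact: pge_degenerate.
  by rewrite peval0 mulr1 ltW.
apply: contrapT => neg.
pose k := (Num.truncn r).+1.
have rk : r < k%:R by apply: truncnS_gt.
have [M M0 hM] := exists_nat_ge (2 / eps).
have {}hM : 2 <= eps * M%:R by move: hM; rewrite ler_pdivrMr // mulrC.
pose Q := adjoin (adjoin ge k%:R u) (M%:R * y) (M%:R * x + 1).
have hQ1 := adjoin_preordered hS k%:R u.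
have hQ : preordered_semiring Q by apply: adjoin_preordered.
have subQ a b : ge a b -> Q a b by move=> ab; do 2!apply: adjoin_sub.
have consQ : consistent Q.
  move=> n [s [d h]]; apply: neg.
  (* Scaled by [V >= M y], the surplus 1 of the inconsistency pays for one more use of the relation,
     which raises the multiplier to [V * s + 1 >= 1]. *)
  have [v hv] := poly_upper_bound (M%:R * y).
  pose V := peval v u.
  apply: (@eliminate_bound x y (V * n%:R) (V * s + 1) (V * d) M k) => //.
    exact: pge_addl.
  have -> : V * n%:R + (V * s + 1) * (M%:R * x + 1) + V * d * u =
    V * (n%:R + s * (M%:R * x + 1) + d * u) + (M%:R * x + 1) by ring.
  apply: (pge_trans hS _ (pge_addr hS h10 _ _)).
  apply: (pge_trans hS _ (pge_mul2l hS _ h)).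
  rewrite -natr1.
  have -> : V * (n%:R + 1 + s * (M%:R * y) + d * k%:R) =
    V + (V * n%:R + V * s * (M%:R * y) + V * d * k%:R) by ring.
  have -> : V * n%:R + (V * s + 1) * (M%:R * y) + V * d * k%:R =
    M%:R * y + (V * n%:R + V * s * (M%:R * y) + V * d * k%:R) by ring.
  exact: pge_add2r.
have archQ : archimedean Q.
  by apply: (@archimedean_of_pge_nat Q k) => //; apply: adjoin_sub; apply: adjoin_rel.
have [f hf] := exists_monotone_hom hQ (subQ _ _ h10) consQ archQ.
have hfge : monotone_hom_Rplus ge f.
  by case: hf => f0 fD fM f01 fmon; split=> // a b /subQ; apply: fmon.
have := fxy f hfge; case: (hf) => _ fD fM [_ f1] fmon.
have := fmon _ _ (adjoin_rel hQ1 (M%:R * y) (M%:R * x + 1)).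
rewrite fD !fM f1 (hom_nat _ hf).
have : 1 <= M%:R :> R by rewrite ler1n.
by nra.
Qed.

(** Since [q(u) x >= 1], the additive term [p(u) z] is at most [p(u) q(u) z x], so [m + p * q]
    serves as the multiplicative factor. *)
Lemma relaxed_add_relaxed_mul x y : x != 0 ->
  (forall r eps : R, 0 <= r -> 0 < eps -> exists p z (m : nat),
    [/\ z != 0, (0 < m)%N, peval p r <= eps * m%:R &
        ge (m%:R * z * x + peval p u * z) (m%:R * z * y)]) ->
  forall r eps : R, 0 <= r -> 0 < eps -> exists p z (m : nat),
    [/\ z != 0, (0 < m)%N, peval p r <= (1 + eps) * m%:R &
        ge (peval p u * z * x) (m%:R * z * y)].
Proof.
move=> x0 H r eps r0 eps0; have [q [qx _]] := hu.2 _ x0.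
have q0 := peval_ge0 q r0; have q1 : 0 < peval q r + 1 by lra.
(* Tolerance [eps / (q(r) + 1)] compensates for the factor [q(r)]; the added 1 keeps the divisor
   positive. *)
have [p [z [m [z0 m0 pm h]]]] := H r _ r0 (divr_gt0 eps0 q1).
exists (m%:P + p * q), z, m; split=> //.
- rewrite pevalD pevalM pevalC mulrDl mul1r lerD2l.
  apply: le_trans (ler_wpM2r q0 pm) _.
  rewrite mulrAC ler_wpM2r ?ler0n // mulrAC ler_pdivrMr //.
  by rewrite ler_wpM2l ?ltW //; lra.
- apply: (pge_trans hS _ _ h); rewrite pevalD pevalM pevalC.
  have -> : (m%:R + peval p u * peval q u) * z * x =
    m%:R * z * x + peval p u * z * (peval q u * x) by ring.
  apply: pge_add2l => //; rewrite -[X in ge _ X]mulr1.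
  exact: pge_mul2l.
Qed.

(** Iteration reuses a single [z], which is then removed by [q(u) >= z] and [q(u) z >= 1]. The cost
    [q(r) ^+ 2] does not depend on [n], so the gap between [1 + eps / 2] and [1 + eps] swallows it
    for some [n]. *)
Lemma relaxed_mul_relaxed_exp x y :
  (forall r eps : R, 0 <= r -> 0 < eps -> exists p z (m : nat),
    [/\ z != 0, (0 < m)%N, peval p r <= (1 + eps) * m%:R &
        ge (peval p u * z * x) (m%:R * z * y)]) ->
  forall r eps : R, 0 <= r -> 0 < eps -> exists p (n m : nat),
    [/\ (0 < n)%N, (0 < m)%N, peval p r <= (1 + eps) ^+ n * m%:R &
        ge (peval p u * x ^+ n) (m%:R * y ^+ n)].
Proof.
move=> H r eps r0 eps0.
have e20 : 0 < eps / 2 by lra.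
have [p [z [m [z0 m0 pm h]]]] := H r _ r0 e20.
have [q [qz zq]] := hu.2 _ z0.
have hn n : ge (peval p u ^+ n * z * x ^+ n) (m%:R ^+ n * z * y ^+ n).
  elim: n => [|n IHn]; first by rewrite !expr0; apply: pge_refl.
  apply: (pge_trans hS (peval p u * x * (m%:R ^+ n * z * y ^+ n))).
    have -> : peval p u ^+ n.+1 * z * x ^+ n.+1 =
      peval p u * x * (peval p u ^+ n * z * x ^+ n) by rewrite !exprS; ring.
    exact: pge_mul2l.
  have -> : peval p u * x * (m%:R ^+ n * z * y ^+ n) =
    peval p u * z * x * (m%:R ^+ n * y ^+ n) by ring.
  have -> : m%:R ^+ n.+1 * z * y ^+ n.+1 =
    m%:R * z * y * (m%:R ^+ n * y ^+ n) by rewrite !exprS; ring.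
  exact: pge_mul2r.
have [|||n n0 dom] := @expr_dominated (1 + eps / 2) (1 + eps) (peval q r * peval q r) 1;
  try lra.
exists (q * q * p ^+ n), n, (m ^ n)%N; split=> //.
- by rewrite expn_gt0 m0.
- rewrite !pevalM peval_exp natrX.
  apply: (@le_trans _ _ (peval q r * peval q r * ((1 + eps / 2) * m%:R) ^+ n)).
    rewrite ler_wpM2l ?mulr_ge0 ?peval_ge0 //.
    by rewrite lerXn2r ?nnegrE ?peval_ge0 // mulr_ge0 ?ler0n //; lra.
  by rewrite exprMn mulrA ler_wpM2r ?exprn_ge0 // -[leRHS]mul1r.
- rewrite !pevalM peval_exp natrX.
  apply: (pge_trans hS (peval q u * (peval p u ^+ n * z * x ^+ n))).
    have -> : peval q u * peval q u * peval p u ^+ n * x ^+ n =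
      peval q u * (peval p u ^+ n * peval q u * x ^+ n) by ring.
    by apply: pge_mul2l => //; apply: pge_mul2r => //; apply: pge_mul2l.
  apply: (pge_trans hS _ (pge_mul2l hS _ (hn n))).
  have -> : peval q u * (m%:R ^+ n * z * y ^+ n) =
    peval q u * z * (m%:R ^+ n * y ^+ n) by ring.
  by rewrite -[X in ge _ X]mul1r; apply: pge_mul2r.
Qed.

(** Taking [r = f u] makes [p(r)] the image of [p(u)]; cancelling [m] and extracting an [n]-th root
    leaves the factor [1 + eps]. *)
Lemma relaxed_exp_hom_le x y :
  (forall r eps : R, 0 <= r -> 0 < eps -> exists p (n m : nat),
    [/\ (0 < n)%N, (0 < m)%N, peval p r <= (1 + eps) ^+ n * m%:R &
        ge (peval p u * x ^+ n) (m%:R * y ^+ n)]) ->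
  forall f, monotone_hom_Rplus ge f -> f y <= f x.
Proof.
move=> H f hf; case: (hf) => f0 _ fM _ fmon.
suff main eps : 0 < eps -> f y <= (1 + eps) * f x.
  (* With [eps = 1 / n], the estimate reads [n * (f y - f x) <= f x]. *)
  rewrite -subr_le0; apply: (@archimedean_le0 _ (f x)) => n n0.
  have n_gt0 : 0 < n%:R :> R by rewrite ltr0n.
  have := main n%:R^-1; rewrite invr_gt0 => /(_ n_gt0).
  rewrite -(ler_pM2l n_gt0) mulrA mulrDr mulfV ?gt_eqF // mulr1.
  by lra.
move=> eps0; have [p [n [m [n0 m0 pm]]]] := H _ _ (f0 u) eps0.
move=> /fmon; rewrite !fM (hom_peval _ _ hf) (hom_nat _ hf) !(hom_exp _ _ hf) => h.
have e0 : 0 <= (1 + eps) * f x by rewrite mulr_ge0 //; lra.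
rewrite -(@ler_pXn2r _ n) ?nnegrE // exprMn.
rewrite -(@ler_pM2l _ m%:R) ?ltr0n //; apply: le_trans h _.
by rewrite mulrA [m%:R * _]mulrC ler_wpM2r // exprn_ge0.
Qed.

End PolynomiallyUniversal.

Unset Implicit Arguments.
Set Strict Implicit.

Theorem theorem2p12 (S : comPzSemiRingType) (ge : S -> S -> Prop)
  (hS : preordered_semiring ge) (hchar : char_zero S) (h10 : ge 1 0)
  (u : S) (hu : poly_universal ge u) (x y : S) (hx : x != 0) (hy : y != 0) :
  [<->
   (forall f : S -> Rdefinitions.R, monotone_hom_Rplus ge f -> f y <= f x);
   (forall (r eps : Rdefinitions.R), 0 <= r -> 0 < eps ->
      exists (p : {poly nat}) (z : S) (m : nat),
        [/\ z != 0, (0 < m)%N, peval p r <= eps * m%:R &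
            ge (m%:R * z * x + peval p u * z) (m%:R * z * y)]);
   (forall (r eps : Rdefinitions.R), 0 <= r -> 0 < eps ->
      exists (p : {poly nat}) (z : S) (m : nat),
        [/\ z != 0, (0 < m)%N, peval p r <= (1 + eps) * m%:R &
            ge (peval p u * z * x) (m%:R * z * y)]);
   (forall (r eps : Rdefinitions.R), 0 <= r -> 0 < eps ->
      exists (p : {poly nat}) (n m : nat),
        [/\ (0 < n)%N, (0 < m)%N, peval p r <= (1 + eps) ^+ n * m%:R &
            ge (peval p u * x ^+ n) (m%:R * y ^+ n)])].
Proof.
tfae.
- exact: hom_le_relaxed_add.
- exact: relaxed_add_relaxed_mul.
- exact: relaxed_mul_relaxed_exp.
- exact: relaxed_exp_hom_le.
Qed.
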